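(* Let $G$ be a completely metrizable topological group with identity $e$, let $d$ be a left-invariant compatible metric on $G$, and let $T\colon G\to G$ be a continuous endomorphism of $G$. Then the following assertions are equivalent: (1) $T$ admits a dense set of distributionally semi-irregular points of type $2$; (2) $T$ admits a residual set of distributionally semi-irregular points of type $2$; (3) there exists $\delta>0$ such that for every sequence $(O_j)_{j\in\mathbb{N}}$ of nonempty open subsets of $G$, there exists a sequence $(K_j)_{j\in\mathbb{N}}$ of Cantor sets with $K_j\subset O_j$ such that $\bigcup_{j=1}^\infty K_j$ is distributionally $\delta$-scrambled of type $2$; (4) the distributionally proximal relation of $T$ is dense in $G\times G$ and $T$ is mean-L-unstable; (5) the distributionally proximal cell of $e$ is dense in $G$ and there exist $x\in G$ and $\delta>0$ such that $\overline{\mathrm{dens}}(\{n\in\mathbb{N}: d(T^nx,e)>\delta\})>0$.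
   Context: A topological group is completely metrizable if its topology is induced by some complete metric. A compatible metric $d$ on $G$ is a metric inducing the topology of $G$ (not required to be complete); it is left-invariant if $d(zx,zy)=d(x,y)$ for all $x,y,z\in G$. A continuous endomorphism is a continuous group homomorphism $G\to G$. $\mathbb{N}$ is the set of positive integers. For $A\subset\mathbb{N}$, $\overline{\mathrm{dens}}(A)=\limsup_{n\to\infty}\frac{\mathrm{card}(A\cap[1,n])}{n}$. A set is residual if it contains a dense $G_\delta$ subset. A Cantor set is a subset homeomorphic to the Cantor ternary set. A point $x\in G$ is distributionally semi-irregular of type $2$ for $T$ if there exists $A\subset\mathbb{N}$ with $\overline{\mathrm{dens}}(A)=1$ such that $\lim_{A\ni n\to\infty}T^nx=e$ and there exists $B\subset\mathbb{N}$ with $\overline{\mathrm{dens}}(B)>0$ such that $\liminf_{B\ni n\to\infty}d(T^nx,e)>0$. A pair $(x,y)\in G\times G$ is distributionally proximal if for every $\varepsilon>0$, $\overline{\mathrm{dens}}(\{n\in\mathbb{N}:d(T^nx,T^ny)<\varepsilon\})=1$; the distributionally proximal relation is the set of all such pairs; the distributionally proximal cell of $x$ is the set of $y$ such that $(x,y)$ is distributionally proximal. For $\delta>0$, a pair $(x,y)$ is distributionally $\delta$-chaotic of type $2$ if it is distributionally proximal and $\overline{\mathrm{dens}}(\{n\in\mathbb{N}:d(T^nx,T^ny)>\delta\})\ge\delta$. A set $K\subset G$ is distributionally $\delta$-scrambled of type $2$ if any two distinct points of $K$ form a distributionally $\delta$-chaotic pair of type $2$. $T$ is mean-L-unstable if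 there exists $\delta>0$ such that for every $x\in G$ and $\varepsilon>0$ there exists $y\in G$ with $d(x,y)<\varepsilon$ such that $\overline{\mathrm{dens}}(\{n\in\mathbb{N}: d(T^nx,T^ny)>\delta\})\ge\delta$. *)

(* Defs.v *)
From HB Require Import structures.
From mathcomp Require Import all_boot all_order all_algebra.
From mathcomp Require Import all_classical all_reals all_analysis.
From mathcomp Require Import borel_hierarchy.

Set Implicit Arguments.
Unset Strict Implicit.
Unset Printing Implicit Defensive.

Import Order.TTheory GRing.Theory Num.Theory.
Import numFieldNormedType.Exports.

Local Open Scope classical_set_scope.
Local Open Scope ring_scope.

HB.mixin Record isTopologicalGroup G of Topological G & Group G := {
  mulg_continuous : continuous (fun x : G * G => (x.1 * x.2)%g) ;
  invg_continuous : continuous (fun x : G => (x^-1)%g)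
}.

#[short(type="topologicalGroupType")]
HB.structure Definition TopologicalGroup :=
  { G of Topological G & Group G & isTopologicalGroup G }.

(* Metrics are unbundled, unlike in [metricType], because several metrics on
   the same topological space are considered at once; the fields are those of
   the factory [isMetric]. *)
Record is_metric (R : realType) (T : Type) (d : T -> T -> R) : Prop := {
  is_metric_xx : forall x, d x x = 0 ;
  is_metric_positivity : forall x y, d x y = 0 -> x = y ;
  is_metric_sym : forall x y, d x y = d y x ;
  is_metric_triangle : forall y x z, d x z <= d x y + d y z
}.

Definition compatible_metric (R : realType) (T : topologicalType)
    (d : T -> T -> R) : Prop :=
  is_metric d /\
  forall x, nbhs_ball_ (fun y e => [set z | d y z < e]) x = nbhs x.

Definition complete_metric (R : realType) (T : Type) (d : T -> T -> R) : Prop :=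
  forall u : nat -> T,
    (forall e : R, 0 < e -> \forall m & n \near \oo, d (u m) (u n) < e) ->
    exists x, forall e : R, 0 < e -> \forall n \near \oo, d (u n) x < e.

Definition completely_metrizable (R : realType) (T : topologicalType) : Prop :=
  exists2 d : T -> T -> R, compatible_metric d & complete_metric d.

Definition left_invariant (R : realType) (G : groupType) (d : G -> G -> R) :
    Prop :=
  forall x y z : G, d (z * x)%g (z * y)%g = d x y.

Definition residual (T : topologicalType) (S : set T) : Prop :=
  exists2 D : set T, Gdelta D /\ dense D & D `<=` S.

(* Points of [0, 1] with a ternary expansion using the digits 0 and 2 only. *)
Definition cantor_ternary (R : realType) : set R :=
  [set x | exists b : nat -> bool,
    series (fun n => 2 * (b n)%:R / 3 ^+ n.+1) @ \oo --> x].

Definition homeomorphic_sets (T U : topologicalType) (A : set T) (B : set U) :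
    Prop :=
  exists (f : T -> U) (g : U -> T),
    [/\ {within A, continuous f}, {within B, continuous g},
        set_fun A B f, set_fun B A g &
        {in A, cancel f g} /\ {in B, cancel g f}].

Definition cantor_set (R : realType) (T : topologicalType) (K : set T) : Prop :=
  homeomorphic_sets (@cantor_ternary R) K.

(* Sets of positive integers are represented by sets of natural numbers: only
   the elements of A in [1, n] are counted, so the membership of 0 is
   irrelevant. The limsup is taken in the extended reals, where it is always
   meaningful. *)
Definition upper_density (R : realType) (A : set nat) : \bar R :=
  limn_esup (fun n => ((count (mem A) (iota 1 n))%:R / n%:R)%:E).

Section distributional_chaos.
Context (R : realType) (G : topologicalGroupType) (d : G -> G -> R).
Variable T : G -> G.

Definition dist_semi_irregular2 (x : G) : Prop :=
  (exists2 A : set nat, upper_density R A = 1%E &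
     iter n T x @[n --> within A \oo] --> (1%g : G)) /\
  (exists2 B : set nat, (0 < upper_density R B)%E &
     (0 < limf_einf (fun n => (d (iter n T x) 1%g)%:E) (within B \oo))%E).

Definition dist_proximal (x y : G) : Prop :=
  forall e : R, 0 < e ->
    upper_density R [set n | d (iter n T x) (iter n T y) < e] = 1%E.

Definition dist_proximal_relation : set (G * G) :=
  [set p | dist_proximal p.1 p.2].

Definition dist_proximal_cell (x : G) : set G := [set y | dist_proximal x y].

Definition dist_chaotic_pair2 (delta : R) (x y : G) : Prop :=
  dist_proximal x y /\
  (delta%:E <=
     upper_density R [set n | (delta < d (iter n T x) (iter n T y))%R])%E.

Definition dist_scrambled2 (delta : R) (K : set G) : Prop :=
  forall x y, K x -> K y -> x <> y -> dist_chaotic_pair2 delta x y.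

Definition mean_L_unstable : Prop :=
  exists2 delta : R, 0 < delta &
    forall (x : G) (e : R), 0 < e ->
      exists2 y : G, d x y < e &
        (delta%:E <=
           upper_density R [set n | (delta < d (iter n T x) (iter n T y))%R])%E.

End distributional_chaos.

(* Main.v *)
Require Import Defs.
From HB Require Import structures.
From mathcomp Require Import all_boot all_order all_algebra.
From mathcomp Require Import all_classical all_reals all_analysis.
From mathcomp Require Import borel_hierarchy.
From mathcomp Require Import lra.

Set Implicit Arguments.
Unset Strict Implicit.
Unset Printing Implicit Defensive.

Import Order.TTheory GRing.Theory Num.Theory.
Import numFieldNormedType.Exports.

Local Open Scope classical_set_scope.
Local Open Scope ring_scope.

(** The key point is that left invariance turns pairs into points: since
    d (T^n x) (T^n y) = d (T^n (x^-1 y)) e, a pair (x, y) is proximal, or far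
    apart often, exactly when the single point x^-1 y has this behaviour with
    respect to e. Everything is therefore read off the functions
    p_n(x) = d (T^n x) e, which are continuous, symmetric under inversion and
    subadditive ([orbit_normV], [orbit_normM]). Let P be the set of points
    whose orbit is close to e along sets of upper density 1, and D_c the set
    of points with p_n > c on a set of upper density at least c. By
    [dist_semi_irregular2P], the distributionally semi-irregular points are the
    points of P that lie in some D_c with c > 0; extracting a single set of
    density 1 along which the orbit converges is the diagonal argument
    [density1_diagonal].

    Assertions (1) to (5) each yield the weak form: P is dense and some D_c,
    c > 0, is nonempty. Conversely, the weak form gives all the rest.
    Subadditivity splits a point x of D_c as y * (x^-1 y)^-1 with y in P and
    x^-1 y near e; one of the two factors is still far from e often. If it is
    y, some iterate of y is near e because y is proximal to e, and a shift does
    not change upper densities. So there are such points arbitrarily near e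
    ([distant_near_id]), and by translation D_c becomes dense for a smaller c
    ([distant_dense]). Both P and D_c are countable intersections of open sets,
    so their intersection is a countable intersection of symmetric open dense
    sets ([bigcap_chaotic_stage]).

    Finally, a theorem of Mycielski ([mycielski]) applies to such an
    intersection D: inside any sequence of open sets there are Cantor subsets of
    D whose union K satisfies x^-1 y in D for all distinct x, y in K. The
    scrambled Cantor sets are these; that they lie in D also gives the density
    of D, hence the residual set. *)

(** * Upper density *)

Section upper_density.
Context (R : realType).
Implicit Types (A B : set nat) (a e : R).

Definition card_upto A (n : nat) : nat := count (mem A) (iota 1 n).

Lemma card_uptoS A n : card_upto A n.+1 = (card_upto A n + (n.+1 \in A))%N.
Proof. by rewrite /card_upto -[in iota 1 n.+1](addn1 n) iotaD count_cat/= addn0. Qed.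

Lemma card_upto_le A n : (card_upto A n <= n)%N.
Proof. by rewrite -[leqRHS](size_iota 1); exact: count_size. Qed.

(** The finitely many indices below N can contribute at most N to the count,
    so only what happens on the window from N to n matters. *)
Lemma card_upto_window A B N n :
    (forall i, (N <= i <= n)%N -> A i -> B i) ->
  (card_upto A n <= card_upto B n + N)%N.
Proof.
elim: n => [//|n IH] AB.
have [nN|Nn] := ltnP n.+1 N.
  by rewrite (leq_trans (card_upto_le _ _))// (leq_trans (ltnW nN))// leq_addl.
rewrite !card_uptoS addnAC leq_add //.
  by apply: IH => i /andP[Ni /leqW ni]; apply: AB; rewrite Ni.
case: (boolP (_ \in A)) => // /set_mem /AB Bn.
by rewrite mem_set//; apply: Bn; rewrite Nn leqnn.
Qed.

Lemma card_uptoU A B n :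
  (card_upto (A `|` B) n <= card_upto A n + card_upto B n)%N.
Proof.
elim: n => [//|n IH]; rewrite !card_uptoS addnACA leq_add // in_setU.
by case: (_ \in A); case: (_ \in B).
Qed.

Lemma card_upto_shift A m n :
  (card_upto A n <= card_upto [set i | A (i + m)%N] n + m)%N.
Proof.
have H k : (card_upto A (k + m) <= card_upto [set i | A (i + m)%N] k + m)%N.
  elim: k => [|k IH]; first by rewrite add0n (leq_trans (card_upto_le _ _))// leq_addl.
  by rewrite addSn !card_uptoS addnAC leq_add// !inE -addSn.
apply: leq_trans (H n); elim: m {H} => [|m IH]; first by rewrite addn0.
by rewrite addnS card_uptoS (leq_trans IH)// leq_addr.
Qed.

(** The inequality a <= [upper_density A] without extended reals or a limsup,
    and without a division, so that n = 0 needs no special treatment: the strict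
    inequality already fails there. *)
Definition density_ge a A : Prop :=
  forall e, 0 < e -> forall N, exists2 n,
    (N <= n)%N & (a - e) * n%:R < (card_upto A n)%:R.

Lemma ge_upper_density a A : (a%:E <= upper_density R A)%E <-> density_ge a A.
Proof.
split=> [aA e e0 N|aA].
- have : (a%:E <= ereal_sup [set ((card_upto A n)%:R / n%:R : R)%:E
                          | n in [set n | (N.+1 <= n)%N]])%E.
    apply: le_trans aA _; apply: ereal_inf_lbound.
    by exists [set n | (N.+1 <= n)%N] => //; exists N.+1.
  move=> aS.
  have : ((a - e)%:E < ereal_sup [set ((card_upto A n)%:R / n%:R : R)%:E
                          | n in [set n | (N.+1 <= n)%N]])%E.
    by apply: lt_le_trans aS; rewrite lte_fin ltrBlDr ltrDl.
  move=> /ereal_sup_gt[_ [n /= Nn <-]]; rewrite lte_fin => nA.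
  exists n; first exact: ltnW.
  by rewrite -ltr_pdivlMr // ltr0n (leq_trans _ Nn).
- apply: le_ereal_inf_tmp => _ [V [N _ NV] <-].
  apply/lee_subgt0Pr => e e0.
  have [n Nn nA] := aA e e0 N.
  have n0 : 0 < n%:R :> R.
    rewrite ltr0n lt0n; apply/eqP => n0.
    by move: nA; rewrite n0 mulr0 /card_upto/= ltxx.
  rewrite -EFinB; apply: (@le_trans _ _ ((card_upto A n)%:R / n%:R : R)%:E).
    by rewrite lee_fin ler_pdivlMr // ltW.
  by apply: ereal_sup_ubound; exists n => //; exact: NV.
Qed.

Lemma upper_density_le1 A : (upper_density R A <= 1)%E.
Proof.
apply: (@le_trans _ _ (ereal_sup [set ((card_upto A n)%:R / n%:R : R)%:E
                          | n in [set: nat]])).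
  by apply: ereal_inf_lbound; exists setT => //; exact: filterT.
apply: ge_ereal_sup => _ [n _ <-]; rewrite lee_fin.
have [->|n0] := posnP n; first by rewrite invr0 mulr0.
by rewrite ler_pdivrMr ?ltr0n // mul1r ler_nat card_upto_le.
Qed.

Lemma upper_density1P A : upper_density R A = 1%E <-> density_ge 1 A.
Proof.
rewrite -ge_upper_density; split=> [->//|A1].
by apply/eqP; rewrite eq_le A1 upper_density_le1.
Qed.

Lemma upper_density_gt0P A : (0 < upper_density R A)%E <->
  exists2 a, 0 < a & density_ge a A.
Proof.
split=> [A0|[a a0 /ge_upper_density]]; last by apply: lt_le_trans; rewrite lte_fin.
case: (upper_density R A) (@ge_upper_density ^~ A) A0 (upper_density_le1 A) => //= r rP.
by rewrite lte_fin => r0 _; exists r => //; apply/rP.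
Qed.

Lemma density_ge_le a b A : b <= a -> density_ge a A -> density_ge b A.
Proof.
move=> ba aA e e0 N; have [n Nn nA] := aA e e0 N; exists n => //.
by apply: le_lt_trans nA; rewrite ler_wpM2r // lerD2r.
Qed.

(** Upper density ignores bounded changes of the counting function; invariance
    under finite modifications and under shifts are both instances. *)
Lemma density_ge_bounded a A B m :
  (forall n, (card_upto A n <= card_upto B n + m)%N) ->
  density_ge a A -> density_ge a B.
Proof.
move=> AB aA e e0 N.
have e20 : 0 < e / 2 by rewrite divr_gt0.
pose k := Num.truncn (m%:R / (e / 2)).
have [n nk nA] := aA _ e20 (maxn N k.+1).
exists n; first exact: leq_trans (leq_maxl _ _) nk.
have : m%:R < e / 2 * n%:R.
  rewrite mulrC -ltr_pdivrMr //; apply: lt_le_trans (truncnS_gt _) _.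
  by rewrite ler_nat; exact: leq_trans (leq_maxr _ _) nk.
have : (card_upto A n)%:R <= (card_upto B n)%:R + m%:R :> R.
  by rewrite -natrD ler_nat.
by move: nA; lra.
Qed.

Lemma density_ge_eventually a A B N : (forall i, (N <= i)%N -> A i -> B i) ->
  density_ge a A -> density_ge a B.
Proof.
move=> AB; apply: (@density_ge_bounded _ _ _ N) => n.
by apply: card_upto_window => i /andP[Ni _]; exact: AB.
Qed.

Lemma density_ge_sub a A B : A `<=` B -> density_ge a A -> density_ge a B.
Proof. by move=> AB; apply: (@density_ge_eventually _ _ _ 0) => i _; exact: AB. Qed.

Lemma density_ge_shift a A m :
  density_ge a A -> density_ge a [set i | A (i + m)%N].
Proof. by apply: density_ge_bounded => n; exact: card_upto_shift. Qed.

(** If both sets had upper density less than a / 2, then both would have few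
    elements up to n for every large n, whereas infinitely many n are rich for
    the union. Taking the negation is what makes the bounds hold at a common n. *)
Lemma density_geU a A B : density_ge a (A `|` B) ->
  density_ge (a / 2) A \/ density_ge (a / 2) B.
Proof.
move=> aAB; apply: contrapT => /not_orP[nA nB].
have bad C : ~ density_ge (a / 2) C -> exists2 e, 0 < e & exists N, forall n,
    (N <= n)%N -> (card_upto C n)%:R <= (a / 2 - e) * n%:R.
  move=> nC; apply: contrapT => h; apply: nC => e e0 N; apply: contrapT => h2.
  apply: h; exists e => //; exists N => n Nn; rewrite leNgt; apply/negP => h3.
  by apply: h2; exists n.
have [e1 e10 [N1 h1]] := bad _ nA.
have [e2 e20 [N2 h2]] := bad _ nB.
have [n nN] := aAB _ (addr_gt0 e10 e20) (maxn N1 N2).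
have {}h1 := h1 _ (leq_trans (leq_maxl _ _) nN).
have {}h2 := h2 _ (leq_trans (leq_maxr _ _) nN).
have : (card_upto (A `|` B) n)%:R <= (card_upto A n)%:R + (card_upto B n)%:R :> R.
  by rewrite -natrD ler_nat card_uptoU.
by move: h1 h2; lra.
Qed.

Lemma density_ge_unbounded a A N : 0 < a -> density_ge a A ->
  exists2 n, (N <= n)%N & A n.
Proof.
move=> a0 aA; apply: contrapT => h.
have : density_ge a set0.
  by apply: (@density_ge_eventually _ _ _ N) aA => i Ni Ai; apply: h; exists i.
move=> /(_ _ a0 0%N)[n _]; rewrite subrr mul0r.
suff -> : card_upto set0 n = 0%N by rewrite ltxx.
by elim: n => // n IH; rewrite card_uptoS IH in_set0.
Qed.

End upper_density.

(** * Convergence along sets of positive upper density *)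

(** The set A asks for u < 1 / (k + 1) beyond a rank N_k, for all k, so that u
    tends to 0 along A by construction. The ranks grow so fast that N_k is
    negligible before N_(k+1), and N_(k+1) is a rank up to which
    the indices with u < 1 / (k + 1) are almost everything; as this condition is
    the strongest one in force up to N_(k+1), A has upper density 1. *)
Lemma density1_diagonal (R : realType) (u : nat -> R) :
  (forall e, 0 < e -> density_ge (1 : R) [set n | u n < e]) ->
  exists2 A : set nat, density_ge (1 : R) A &
    forall e, 0 < e -> exists N, forall n, (N <= n)%N -> A n -> u n < e.
Proof.
move=> u0.
have inv0 k : 0 < k.+1%:R^-1 :> R by rewrite invr_gt0.
have small e : 0 < e -> exists k, k.+1%:R^-1 < e :> R.
  move=> e0; exists (Num.truncn e^-1).
  by rewrite -[ltRHS]invrK ltf_pV2 ?posrE ?invr_gt0// truncnS_gt.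
have /choice[f fP] (p : nat * nat) : exists n, (p.2 <= n)%N /\
    (1 - p.1.+1%:R^-1) * n%:R < (card_upto [set i | u i < p.1.+1%:R^-1] n)%:R :> R.
  by have [n pn np] := u0 _ (inv0 p.1) _ (inv0 p.1) p.2; exists n.
(* The product k.+1 * N k makes N k a small fraction of N k.+1; the extra
   k.+1 makes the ranks unbounded. *)
pose N := fix N k := if k is k'.+1 then f (k', k'.+1 * N k' + k'.+1)%N else 0%N.
have NS k : (k.+1 * N k + k.+1 <= N k.+1)%N by have [] := fP (k, k.+1 * N k + k.+1)%N.
have Nmono : {homo N : i j / (i <= j)%N}.
  apply: homo_leq => // [? ? ?|k]; first exact: leq_trans.
  by rewrite (leq_trans _ (NS k))// mulSn -addnA leq_addr.
have leN k : (k <= N k)%N.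
  by case: k => // k; rewrite (leq_trans _ (NS k))// leq_addl.
exists [set i | forall k, (N k < i)%N -> u i < k.+1%:R^-1]; last first.
  move=> e /small[k ke]; exists (N k).+1 => n kn /(_ _ kn) un.
  exact: lt_trans ke.
move=> e e0 M.
have [k ke] := small _ (divr_gt0 e0 (ltr0n R 2)).
pose m := maxn k M.
have me : m.+1%:R^-1 < e / 2.
  by apply: le_lt_trans ke; rewrite lef_pV2 ?posrE// ler_nat ltnS leq_maxl.
exists (N m.+1).
  by rewrite (leq_trans _ (leN _))// leqW// leq_maxr.
have [_ /=] := fP (m, m.+1 * N m + m.+1)%N.
rewrite -[f _]/(N m.+1) => Nm.
have : (card_upto [set i | (u i < m.+1%:R^-1)%R] (N m.+1) <= card_upto
    [set i | forall k, (N k < i)%N -> (u i < k.+1%:R^-1)%R] (N m.+1) + N m)%N.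
  apply: card_upto_window => i /andP[_ iN] /= ui j Nji.
  apply: lt_le_trans ui _; rewrite lef_pV2 ?posrE// ler_nat ltnS.
  rewrite -ltnS ltnNge; apply/negP => /Nmono; apply/negP.
  by rewrite -ltnNge (leq_trans Nji).
rewrite -(ler_nat R) natrD.
have : (N m)%:R <= m.+1%:R^-1 * (N m.+1)%:R :> R.
  rewrite mulrC ler_pdivlMr // -natrM ler_nat mulnC.
  by rewrite (leq_trans _ (NS _))// leq_addr.
have : m.+1%:R^-1 * (N m.+1)%:R <= e / 2 * (N m.+1)%:R.
  by rewrite ler_wpM2r// ltW.
move: Nm; set c : R := m.+1%:R^-1; set x : R := (N m.+1)%:R; set y : R := (N m)%:R.
set p : R := (card_upto _ _)%:R; set q : R := (card_upto _ _)%:R.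
clearbody c x y p q; rewrite !mulrBl; lra.
Qed.

Lemma limf_einf_gt0P (R : realType) (u : nat -> R) (B : set nat) :
  (0 < limf_einf (fun n => (u n)%:E) (within B \oo))%E <->
  exists2 a : R, 0 < a & \forall n \near \oo, B n -> a < u n.
Proof.
rewrite /limf_einf /limf_esup lteNr oppe0; split=> [/ereal_inf_lt|].
  move=> [_ [V BV0 <-]]; have BV : \forall n \near \oo, B n -> V n := BV0.
  set s := ereal_sup _ => s0.
  have us n : V n -> (- (u n)%:E <= s)%E by move=> Vn; apply: ereal_sup_ubound; exists n.
  case: s s0 us => [r||] // r0 us.
  - exists (- r / 2); first by rewrite divr_gt0// oppr_gt0.
    apply: filterS BV => n Vn /Vn/us; rewrite -EFinN lee_fin.
    by rewrite lerNl => + ; rewrite lte_fin in r0; apply: lt_le_trans; lra.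
  - exists 1 => //; apply: filterS BV => n Vn /Vn/us.
    by rewrite -EFinN.
move=> [a a0 ua]; apply: (@le_lt_trans _ _ (- a)%:E); last first.
  by rewrite lte_fin oppr_lt0.
apply: (@le_trans _ _ (ereal_sup [set (- (u n)%:E)%E | n in [set n | a < u n]])).
  apply: ereal_inf_lbound.
  by exists [set n | a < u n].
apply: ge_ereal_sup => _ [n /= /ltW an <-].
by suff : ((- u n)%:E <= (- a)%:E)%E; rewrite ?lee_fin ?lerN2.
Qed.

(** * The ternary Cantor set and Cantor schemes *)

Definition agree (n : nat) (b b' : nat -> bool) : Prop :=
  forall i, (i < n)%N -> b i = b' i.

Lemma agree_sym n b b' : agree n b b' -> agree n b' b.
Proof. by move=> bb i ni; rewrite bb. Qed.

Section ternary.
Context (R : realType).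
Implicit Types (b : nat -> bool).

Definition ternary_partial b : R^nat :=
  series (fun n => 2 * (b n)%:R / 3 ^+ n.+1).

Definition ternary b : R := limn (ternary_partial b).

Lemma ternary_partialS b n : ternary_partial b n.+1 =
  ternary_partial b n + 2 * (b n)%:R / 3 ^+ n.+1.
Proof. by rewrite /ternary_partial !seriesEnat/= big_nat_recr. Qed.

Lemma ternary_partial_agree b b' n : agree n b b' ->
  ternary_partial b n = ternary_partial b' n.
Proof.
elim: n => [|n IH] bb; first by rewrite /ternary_partial !seriesEnat/= !big_nil.
by rewrite !ternary_partialS bb// IH// => i /ltnW; exact: bb.
Qed.

(** The remainder of the series after n terms is at most the sum of
    2 / 3^(k+1) over k >= n, which is 3^-n; keeping the term 3^-m makes
    the induction go through. *)
Lemma ternary_partial_bounds b n m : (n <= m)%N ->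
  ternary_partial b n <= ternary_partial b m <=
  ternary_partial b n + 3^-1 ^+ n - 3^-1 ^+ m.
Proof.
elim: m => [|m IH]; first by rewrite leqn0 => /eqP ->; rewrite addrK lexx.
rewrite leq_eqVlt => /orP[/eqP <-|/IH /andP[IH1 IH2]].
  by rewrite addrK lexx.
rewrite ternary_partialS -exprVn exprS.
have : 0 <= (3^-1 : R) ^+ m by rewrite exprn_ge0.
move: IH1 IH2; move: (_ ^+ m) => x; case: (b m) => /=; lra.
Qed.

Lemma cvg_ternary b : ternary_partial b @ \oo --> ternary b.
Proof.
apply: nondecreasing_is_cvgn.
  by move=> n m /(ternary_partial_bounds b) /andP[].
exists 1 => _ [n _ <-].
have /andP[_] := ternary_partial_bounds b (leq0n n).
rewrite {2}/ternary_partial seriesEnat/= big_nil expr0 => /le_trans; apply.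
by rewrite add0r gerBl exprn_ge0.
Qed.

Lemma ternary_bounds b n :
  ternary_partial b n <= ternary b <= ternary_partial b n + 3^-1 ^+ n.
Proof.
have tc : cvgn (ternary_partial b) by exact: (cvgP _ (@cvg_ternary b)).
have near_bounds : \forall m \near \oo,
    ternary_partial b n <= ternary_partial b m <= ternary_partial b n + 3^-1 ^+ n.
  apply: filterS (nbhs_infty_ge n) => m /(ternary_partial_bounds b)/andP[-> /=].
  by move=> /le_trans; apply; rewrite gerBl exprn_ge0.
apply/andP; split.
  by apply: limr_ge => //; apply: filterS near_bounds => m /andP[].
by apply: limr_le => //; apply: filterS near_bounds => m /andP[].
Qed.

Lemma ternary_agree b b' n : agree n b b' ->
  `|ternary b - ternary b'| <= 3^-1 ^+ n.
Proof.
move=> /ternary_partial_agree bb.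
have := ternary_bounds b n; have := ternary_bounds b' n; rewrite bb ler_norml.
move=> /andP[? ?] /andP[? ?]; apply/andP; split; lra.
Qed.

(** At the first index i where the digits differ, the digit 2 gains
    2 / 3^(i+1), of which the later digits of the other expansion can recover at
    most 3^-(i+1). *)
Lemma agree_ternary b b' n :
  `|ternary b - ternary b'| < 3^-1 ^+ n -> agree n b b'.
Proof.
wlog suff H : b b' / forall i, (i < n)%N -> agree i b b' -> b i -> ~~ b' i ->
    3^-1 ^+ n <= `|ternary b - ternary b'|.
  move=> bn; elim/ltn_ind => i IH iN.
  have bbi : agree i b b' by move=> j ji; apply: IH => //; exact: ltn_trans iN.
  case Ebi : (b i); case Eb'i : (b' i) => //.
    by move: (H b b' i iN bbi); rewrite Ebi Eb'i leNgt bn => /(_ isT isT).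
  by move: (H b' b i iN (agree_sym bbi)); rewrite Ebi Eb'i distrC leNgt bn => /(_ isT isT).
move=> i iN /ternary_partial_agree bb bi b'i.
have /andP[h _] := ternary_bounds b i.+1.
have /andP[_ h'] := ternary_bounds b' i.+1.
apply: le_trans (ler_norm _); move: h h'.
rewrite !ternary_partialS bb bi (negbTE b'i) -exprVn /= => h h'.
have : (3^-1 : R) ^+ n <= 3^-1 ^+ i.+1.
  by apply: ler_wiXn2l => //; lra.
lra.
Qed.

Lemma cantor_ternaryP x : cantor_ternary x <-> exists b, x = ternary b.
Proof.
split=> [[b bx]|[b ->]]; exists b; last exact: cvg_ternary.
exact/esym/(cvg_lim _ bx).
Qed.

End ternary.

(** Continuity of phi and of its inverse on the image are stated with the
    cylinders of binary sequences, which is how they come out of a tree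
    construction; the second condition also forces injectivity. Since [ternary]
    has the same two properties, it identifies the image with the ternary Cantor
    set. *)
Lemma cantor_set_range (R : realType) (X : topologicalType)
    (phi : (nat -> bool) -> X) :
    (forall b A, nbhs (phi b) A ->
      exists n, forall b', agree n b b' -> A (phi b')) ->
    (forall b n, \forall y \near phi b, forall b', phi b' = y -> agree n b b') ->
  cantor_set R (range phi).
Proof.
move=> phi_cont phi_inv.
have phi_inj : injective phi.
  move=> b b' bb; apply/funext => i.
  by have /nbhs_singleton/(_ b')/(_ (esym bb))/(_ i (ltnSn i)) := phi_inv b i.+1.
have tern_inj : injective (@ternary R).
  move=> b b' bb; apply/funext => i.
  apply: (@agree_ternary R b b' i.+1) => //.
  by rewrite bb subrr normr0 exprn_gt0.
have /choice[dig digP] (x : R) : exists b, cantor_ternary x -> ternary R b = x.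
  have [/cantor_ternaryP[b ->]|nx] := pselect (cantor_ternary x); first by exists b.
  by exists (fun=> true).
have /choice[pre preP] (y : X) : exists b, range phi y -> phi b = y.
  have [[b _ yb]|ny] := pselect (range phi y); first by exists b.
  by exists (fun=> true).
exists (phi \o dig), (@ternary R \o pre); split.
- apply/subspace_continuousP => x xC A /= /phi_cont[n nA].
  have : \forall y \near x, `|x - y| < 3^-1 ^+ n.
    by apply: nbhsx_ballx; rewrite exprn_gt0.
  apply: filterS => y xy yC; apply: nA; apply: (@agree_ternary R).
  by rewrite !digP.
- apply/subspace_continuousP => _ [b _ <-] A /= /nbhs_ballP[e /= e0 eA].
  have [n ne] : exists n, (3^-1 : R) ^+ n < e.
    have n3 : `|3^-1 : R| < 1 by rewrite ger0_norm//; lra.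
    have [N _ /(_ N (leqnn N))] := cvgr_dist_lt _ _ (cvg_expr n3) _ e0.
    by rewrite /= sub0r normrN => /(le_lt_trans (ler_norm _)); exists N.
  apply: filterS (phi_inv b n) => y yb yphi; apply: eA.
  change (`|ternary R (pre (phi b)) - ternary R (pre y)| < e).
  have -> : pre (phi b) = b by apply: phi_inj; apply: preP; exists b.
  apply: le_lt_trans ne; apply: ternary_agree; apply: yb; exact: preP.
- by move=> x xC /=; exists (dig x).
- by move=> y yphi /=; apply/cantor_ternaryP; exists (pre y).
- split=> [x /set_mem xC|y /set_mem yphi] /=.
    have -> : pre (phi (dig x)) = dig x.
      by apply: phi_inj; apply: preP; exists (dig x).
    exact: digP.
  have -> : dig (ternary R (pre y)) = pre y.
    by apply: tern_inj; apply: digP; apply/cantor_ternaryP; exists (pre y).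
  exact: preP.
Qed.

(** * Balls of a compatible metric *)

Section metric.
Context (R : realType) (X : topologicalType) (rho : X -> X -> R).
Hypothesis rhoC : compatible_metric rho.

Lemma nbhs_metricP x (A : set X) :
  nbhs x A <-> exists2 e, 0 < e & forall z, rho x z < e -> A z.
Proof. by have [_ <-] := rhoC; split=> [[e /= e0 eA]|[e e0 eA]]; exists e. Qed.

Lemma open_metric_ball x e : open [set z | rho x z < e].
Proof.
have [[_ _ _ tri] _] := rhoC.
rewrite openE => y /= xy; apply/nbhs_metricP.
exists (e - rho x y); first by rewrite subr_gt0.
by move=> z yz /=; have := tri y x z; lra.
Qed.

Lemma continuous_metric_to y : continuous (fun x => rho x y).
Proof.
have [[_ _ sym tri] _] := rhoC.
move=> x A /= /nbhs_ballP[e /= e0 eA]; apply/nbhs_metricP; exists e => // z xz.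
apply: eA; change (`|rho x y - rho z y| < e).
rewrite ltr_norml; have := tri z x y; have := tri x z y; rewrite (sym z x).
by move=> ? ?; apply/andP; split; lra.
Qed.

(** The factor 3 leaves room for the limit to lie strictly inside each ball:
    the next centre is within r / 3 and the limit is within r / 3 of that. *)
Lemma nested_balls (c : nat -> X) (r : nat -> R) : complete_metric rho ->
    (forall n, 0 < r n) -> (forall n, rho (c n) (c n.+1) <= r n / 3) ->
    (forall n, r n.+1 <= r n / 3) ->
  exists x, forall n, rho (c n) x < r n.
Proof.
move=> rho_complete r0 cS rS; have [[_ _ sym tri] _] := rhoC.
have nest n m : (n <= m)%N -> rho (c n) (c m) + r m <= r n.
  elim: m => [|m IH]; rewrite leq_eqVlt => /predU1P[->|]; rewrite ?ltnS.
  - by case: rhoC => -[-> _ _ _ _]; rewrite add0r.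
  - by [].
  - by case: rhoC => -[-> _ _ _ _]; rewrite add0r.
  - move=> /IH; have := tri (c m) (c n) (c m.+1); have := cS m; have := rS m.
    by have := r0 m; lra.
have r_small e : 0 < e -> exists N, r N < e.
  move=> e0.
  have rn n : r n * n.+1%:R <= r 0.
    elim: n => [|n IH]; first by rewrite mulr1.
    apply: le_trans IH; have := r0 n => rn0; have := ltW (r0 n.+1) => rn1.
    apply: (@le_trans _ _ (r n / 3 * n.+2%:R)); first by rewrite ler_wpM2r.
    rewrite -mulrA; apply: ler_wpM2l; first exact: ltW.
    rewrite mulrC ler_pdivrMr// -natrM ler_nat.
    by rewrite (@leq_trans (n.+1 * 2))// ?leq_mul2l// muln2 -addnn addSn ltnS leq_addl.
  pose N := Num.truncn (r 0 / e); exists N.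
  have : r 0 < e * N.+1%:R.
    by rewrite mulrC -ltr_pdivrMr//; exact: truncnS_gt.
  by move=> /(le_lt_trans (rn N)); rewrite ltr_pM2r.
have [|x cx] := rho_complete c.
  move=> e e0; have [N Ne] := r_small (e / 2) (divr_gt0 e0 (ltr0Sn _ 1)).
  near=> m n.
  have /nest mN : (N <= m)%N by near: m; exact: nbhs_infty_ge.
  have /nest nN : (N <= n)%N by near: n; exact: nbhs_infty_ge.
  have := tri (c N) (c m) (c n); rewrite (sym (c m) (c N)).
  by have := r0 m; have := r0 n; lra.
exists x => n.
suff : rho (c n.+1) x <= r n.+1.
  by have := tri (c n.+1) (c n) x; have := cS n; have := rS n; have := r0 n; lra.
rewrite leNgt; apply/negP => rx.
have [m [mn mx]] : exists m, (n.+1 <= m)%N /\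
    rho (c m) x < rho (c n.+1) x - r n.+1.
  have [|N _ NP] := cx (rho (c n.+1) x - r n.+1); first by rewrite subr_gt0.
  by exists (maxn n.+1 N); split; [exact: leq_maxl|exact/NP/leq_maxr].
by have := nest _ _ mn; have := tri (c m) (c n.+1) x; have := r0 m; lra.
Unshelve. all: by end_near. Qed.

End metric.

(** * Open dense sets in a topological group *)

Section group_topology.
Context (G : topologicalGroupType).
Implicit Types (A F O : set G).

Lemma continuous_mulgl (x : G) : continuous (fun y : G => (x * y)%g).
Proof.
move=> y; apply: (@continuous_comp _ _ _ (fun y => (x, y)) (fun p : G * G => (p.1 * p.2)%g)).
  by apply: cvg_pair; [exact: cvg_cst|exact: cvg_id].
exact: mulg_continuous.
Qed.

Lemma open_translate (x : G) F : open F -> open [set y | F (x^-1 * y)%g].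
Proof. by move=> Fo; apply: open_comp Fo => y _; exact: continuous_mulgl. Qed.

Lemma dense_translate (x : G) F : dense F -> dense [set y | F (x^-1 * y)%g].
Proof.
move=> Fd O [y Oy] Oo.
have [||z [/= Oz Fz]] := Fd [set z | O (x * z)%g].
- by exists (x^-1 * y)%g; rewrite /= mulVKg.
- by have := @open_translate x^-1%g _ Oo; rewrite invgK.
- by exists (x * z)%g; split=> //=; rewrite mulKg.
Qed.

Lemma continuous_ldivg : continuous (fun p : G * G => (p.1^-1 * p.2)%g).
Proof.
move=> p; apply: (@continuous_comp _ _ _ (fun p : G * G => (p.1^-1%g, p.2))
  (fun p : G * G => (p.1 * p.2)%g)); last exact: mulg_continuous.
apply: cvg_pair; last exact: cvg_snd.
apply: (@continuous_comp _ _ _ fst (fun x : G => x^-1%g)); first exact: cvg_fst.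
exact: invg_continuous.
Qed.

Lemma meet_open_dense (I : eqType) (L : seq I) (D : I -> set G) O :
    (forall i, i \in L -> open (D i) /\ dense (D i)) ->
    open O -> O !=set0 ->
  exists2 x, O x & forall i, i \in L -> D i x.
Proof.
elim: L O => [|i L IH] O DL Oo On; first by case: On => x Ox; exists x.
have [Do Dd] := DL i (mem_head _ _).
have [|||x [Ox Dx] Lx] := IH (O `&` D i).
- by move=> k kL; apply: DL; rewrite inE kL orbT.
- exact: openI.
- exact: Dd.
by exists x => // k; rewrite inE => /predU1P[->|/Lx].
Qed.

(** The points are chosen one after the other: a new point has to lie in F
    and in the translates x F by the earlier points, which are finitely many open
    dense sets, and the symmetry of F takes care of the reversed pairs. *)
Lemma pick_independent (I : eqType) (L : seq I) (W : I -> set G) F :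
    open F -> dense F -> (forall x, F x -> F x^-1%g) ->
    (forall i, open (W i) /\ W i !=set0) -> uniq L ->
  exists x : I -> G, [/\ forall i, W i (x i), forall i, i \in L -> F (x i) &
    forall i j, i \in L -> j \in L -> i != j -> F ((x i)^-1 * x j)%g].
Proof.
move=> Fo Fd Fs WP; elim: L => [_|i L IH /= /andP[iL Lu]].
  have /choice[x xP] i : exists x, W i x by have [_] := WP i.
  by exists x.
have [x [xW xF xP]] := IH Lu; have [Wo Wn] := WP i.
have [|||y [Wy Fy] yP] := @meet_open_dense _ L
    (fun k => [set y | F ((x k)^-1 * y)%g]) (W i `&` F).
- by move=> k _; split; [exact: open_translate|exact: dense_translate].
- exact: openI.
- exact: Fd.
pose x' k := if k == i then y else x k.
have x'i : x' i = y by rewrite /x' eqxx.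
have x'L k : k \in L -> x' k = x k.
  by rewrite /x'; case: eqP => // ->; rewrite (negbTE iL).
exists x'; split.
- by move=> k; rewrite /x'; case: eqP => // ->.
- by move=> k; rewrite inE => /predU1P[->|kL]; rewrite ?x'i ?x'L//; exact: xF.
- move=> k l; rewrite !inE => /predU1P[->|kL] /predU1P[->|lL].
  + by rewrite eqxx.
  + move=> _; rewrite x'i x'L//; have := Fs _ (yP _ lL).
    by rewrite invgM invgK.
  + by move=> _; rewrite x'i x'L//; exact: yP.
  + by rewrite !x'L//; exact: xP.
Qed.

End group_topology.

Lemma common_radius (R : realType) (I : eqType) (L : seq I) (P : I -> R -> Prop) :
    (forall i e e', e' <= e -> P i e -> P i e') ->
    (forall i, i \in L -> exists2 e, 0 < e & P i e) ->
  exists2 e, 0 < e & forall i, i \in L -> P i e.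
Proof.
move=> Pmono; elim: L => [|i L IH] LP; first by exists 1.
have [e e0 eP] := LP i (mem_head _ _).
have [|e' e'0 e'P] := IH; first by move=> k kL; apply: LP; rewrite inE kL orbT.
exists (Num.min e e'); first by rewrite lt_min e0.
move=> k; rewrite inE => /predU1P[->|kL]; apply: Pmono; [|exact: eP| |exact: e'P kL].
  by rewrite ge_min lexx.
by rewrite ge_min lexx orbT.
Qed.

(** * Mycielski's theorem for translation-invariant relations *)

Section mycielski.
Context (R : realType) (G : topologicalGroupType) (rho : G -> G -> R).
Hypothesis rhoC : compatible_metric rho.

Let inball (p : G * R) (x : G) := rho p.1 x < p.2.

(** One level of the tree of balls: each ball [S (parent i)] receives a child
    [S' i], and the children with index in the finite list L are in general
    position with respect to F, uniformly over the balls and not only at the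
    centres. *)
Lemma refine_balls (I : eqType) (L : seq I) (parent : I -> I)
    (S : I -> G * R) (F : set G) :
    uniq L -> open F -> dense F -> (forall x, F x -> F x^-1%g) ->
    (forall i, 0 < (S i).2) ->
  exists S' : I -> G * R, [/\
    forall i, 0 < (S' i).2,
    forall i, rho (S (parent i)).1 (S' i).1 <= (S (parent i)).2 / 3,
    forall i, (S' i).2 <= (S (parent i)).2 / 3 &
    forall i j x y, i \in L -> j \in L -> inball (S' i) x -> inball (S' j) y ->
      F x /\ (i != j -> F (x^-1 * y)%g)].
Proof.
move=> Lu Fo Fd Fs S0.
have r0 i : 0 < (S (parent i)).2 / 3 by rewrite divr_gt0.
have [|x [xW xF xP]] := @pick_independent G I L
    (fun i => [set z | rho (S (parent i)).1 z < (S (parent i)).2 / 3]) F Fo Fd Fs _ Lu.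
  move=> i; split; first exact: open_metric_ball.
  by exists (S (parent i)).1 => /=; have [[-> _ _ _] _] := rhoC.
have [||e e0 eP] := @common_radius R (I * I)%type [seq (i, j) | i <- L, j <- L]
    (fun p e => forall y z, rho (x p.1) y < e -> rho (x p.2) z < e ->
      F y /\ (p.1 != p.2 -> F (y^-1 * z)%g)).
- move=> p e e' ee' H y z ye ze; apply: H; exact: lt_le_trans ee'.
- move=> p /allpairsP[[i j] /= [iL jL ->]] /=.
  have : nbhs (x i) F by apply: open_nbhs_nbhs; split => //; exact: xF.
  move=> /(nbhs_metricP rhoC)[e1 e10 e1F].
  have [ij|ij] := eqVneq i j.
    by exists e1 => // y z /e1F.
  have /(continuous_ldivg (x := (x i, x j)))[[/= A B]] :
      nbhs ((x i)^-1 * x j)%g F by apply: open_nbhs_nbhs; split => //; exact: xP.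
  move=> [/= /(nbhs_metricP rhoC)[e2 e20 e2A] /(nbhs_metricP rhoC)[e3 e30 e3B]] AB.
  exists (Num.min e1 (Num.min e2 e3)); first by rewrite !lt_min e10 e20.
  move=> y z; rewrite !lt_min => /and3P[y1 y2 _] /and3P[_ _ z3].
  split; first exact: e1F.
  by move=> _; apply: (AB (y, z)); split; [exact: e2A|exact: e3B].
exists (fun i => (x i, Num.min e ((S (parent i)).2 / 3))); split => /=.
- by move=> i; rewrite lt_min e0 r0.
- by move=> i; exact/ltW/xW.
- by move=> i; rewrite ge_min lexx orbT.
- move=> i j y z iL jL; rewrite /inball/= !lt_min => /andP[ye _] /andP[ze _].
  by apply: (eP (i, j)) => //; apply/allpairsP; exists (i, j).
Qed.

Let word (n : nat) (i : nat * (nat -> bool)) : nat * seq bool :=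
  (i.1, mkseq i.2 n).

(* At level n only the first n + 1 trees are put in general position: this
   keeps the list finite, and each pair of branches is eventually handled. *)
Let active (n : nat) : seq (nat * seq bool) :=
  [seq (j, val s) | j <- iota 0 n.+1, s <- enum {: n.+1.-tuple bool}].

Let active_uniq n : uniq (active n).
Proof.
apply: allpairs_uniq; [exact: iota_uniq|exact: enum_uniq|].
by move=> [j s] [j' s'] _ _ /= [-> /val_inj ->].
Qed.

Let word_active n i : (i.1 <= n)%N -> word n.+1 i \in active n.
Proof.
move=> ni; apply/allpairsP.
have sn : size (mkseq i.2 n.+1) == n.+1 by rewrite size_mkseq.
by exists (i.1, Tuple sn); split; rewrite ?mem_iota ?mem_enum.
Qed.

Let parent (n : nat) (i : nat * seq bool) := (i.1, take n i.2).

Let parent_word n i : parent n (word n.+1 i) = word n i.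
Proof. by rewrite /parent /word /= /mkseq -map_take take_iota (minn_idPl _). Qed.

Let mkseq_agree n b b' : mkseq b n = mkseq b' n -> agree n b b'.
Proof. by move=> bb i ni; rewrite -(nth_mkseq true b ni) bb nth_mkseq. Qed.

Let agree_mkseq n b b' : agree n b b' -> mkseq b n = mkseq b' n.
Proof.
by move=> bb; apply/eq_in_map => i; rewrite mem_iota add0n => /andP[_ /bb].
Qed.

(** The Cantor sets are the sets of branches of trees of balls, one tree
    starting in each [O j], all trees being grown simultaneously. At level n the
    balls are refined so that u^-1 v lies in [F n] for u and v in different
    balls; two distinct branches are in different balls from some level on, and
    F decreases, so their quotient lies in every [F n]. As the identity is missing
    from some [F n], the balls of a deep level are disjoint, which makes
    the coding by branches a homeomorphism. *)
Theorem mycielski (F : nat -> set G) (O : nat -> set G) :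
    complete_metric rho ->
    (forall n, open (F n)) -> (forall n, dense (F n)) ->
    (forall n x, F n x -> F n x^-1%g) ->
    (forall n, F n.+1 `<=` F n) -> ~ (\bigcap_n F n) 1%g ->
    (forall j, open (O j) /\ O j !=set0) ->
  exists K : nat -> set G,
    (forall j, cantor_set R (K j) /\ K j `<=` O j `&` \bigcap_n F n) /\
    forall x y, (\bigcup_j K j) x -> (\bigcup_j K j) y -> x <> y ->
      (\bigcap_n F n) (x^-1 * y)%g.
Proof.
move=> rho_complete Fo Fd Fs FS F1 OP.
have [[rho_xx _ rho_sym rho_tri] _] := rhoC.
have Fmono m n : (n <= m)%N -> F m `<=` F n.
  elim: m => [|m IH]; first by rewrite leqn0 => /eqP ->.
  by rewrite leq_eqVlt => /predU1P[->//|/IH] mn x /FS/mn.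
have [n1 Fn1] : exists n, ~ F n 1%g.
  by apply: contrapT => h; apply: F1 => n _; apply: contrapT => nF; apply: h; exists n.
have /choice[B BP] j : exists p : G * R, 0 < p.2 /\ forall x, inball p x -> O j x.
  have [Oo [x Ox]] := OP j.
  have /(nbhs_metricP rhoC)[e e0 eO] : nbhs x (O j) by apply: open_nbhs_nbhs.
  by exists (x, e).
pose good (S : nat * seq bool -> G * R) := forall i, 0 < (S i).2.
pose step n (S S' : nat * seq bool -> G * R) := [/\ good S',
  forall i, rho (S (parent n i)).1 (S' i).1 <= (S (parent n i)).2 / 3,
  forall i, (S' i).2 <= (S (parent n i)).2 / 3 &
  forall i j x y, i \in active n -> j \in active n ->
    inball (S' i) x -> inball (S' j) y -> F n x /\ (i != j -> F n (x^-1 * y)%g)].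
have /choice[next nextP] (p : nat * (nat * seq bool -> G * R)) :
    exists S', good p.2 -> step p.1 p.2 S'.
  have [gS|] := pselect (good p.2); last by exists p.2.
  have [S' SP] := refine_balls (parent p.1) (active_uniq p.1) (Fo p.1) (Fd p.1) (@Fs p.1) gS.
  by exists S'.
(* Initially the ball only depends on the tree: only the empty word is used. *)
pose S := fix S n := if n is m.+1 then next (m, S m) else fun i => B i.1.
have Sgood n : good (S n).
  by elim: n => [i|n /(nextP (n, S n))[]//]; have [] := BP i.1.
have Sstep n : step n (S n) (S n.+1) by exact: (nextP (n, S n)) (Sgood n).
have /choice[phi phiP] i : exists x, forall n, inball (S n (word n i)) x.
  apply: (nested_balls rhoC rho_complete) => n.
  - exact: Sgood.
  - by have [_ + _ _] := Sstep n => /(_ (word n.+1 i)); rewrite parent_word.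
  - by have [_ _ + _] := Sstep n => /(_ (word n.+1 i)); rewrite parent_word.
have phiF n i j : (i.1 <= n)%N -> (j.1 <= n)%N ->
    F n (phi i) /\ (word n.+1 i != word n.+1 j -> F n ((phi i)^-1 * phi j)%g).
  move=> iN jN; have [_ _ _ SF] := Sstep n.
  by apply: SF; [exact: word_active|exact: word_active|exact: phiP|exact: phiP].
have radius_small j e : 0 < e -> exists n, forall b, (S n (word n (j, b))).2 < e.
  move=> e0.
  have rn n b : (S n (word n (j, b))).2 <= (B j).2 * 3^-1 ^+ n.
    elim: n => [|n IH]; first by rewrite mulr1.
    have [_ _ + _] := Sstep n => /(_ (word n.+1 (j, b))); rewrite parent_word.
    by move=> /le_trans; apply; rewrite exprSr mulrA ler_wpM2r.
  have n3 : `|3^-1 : R| < 1 by rewrite ger0_norm//; lra.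
  have Bj : 0 < (B j).2 by have [] := BP j.
  have [n _ /(_ n (leqnn n))] := cvgr_dist_lt _ _ (cvg_expr n3) _ (divr_gt0 e0 Bj).
  rewrite /= sub0r normrN => /(le_lt_trans (ler_norm _)).
  rewrite ltr_pdivlMr// mulrC => ne; exists n => b; exact: le_lt_trans (rn n b) ne.
exists (fun j => range (fun b => phi (j, b))); split=> [j|]; first split.
- apply: cantor_set_range => [b A /(nbhs_metricP rhoC)[e e0 eA]|b n].
    have [n nP] := radius_small j (e / 2) (divr_gt0 e0 (ltr0Sn _ 1)).
    exists n => b' /agree_mkseq bb; apply: eA.
    have := phiP (j, b) n; have := phiP (j, b') n; have := nP b.
    rewrite /inball /word /= -bb; set c := (S n _).1 => rn cb' cb.
    by have := rho_tri c (phi (j, b)) (phi (j, b')); rewrite (rho_sym _ c); lra.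
  (* A point in the balls of two different words would put y^-1 y = 1 in F m. *)
  pose m := maxn n (maxn j n1).
  have [nm jm n1m] : [/\ (n <= m)%N, (j <= m)%N & (n1 <= m)%N].
    by split; rewrite !leq_max leqnn ?orbT.
  have : nbhs (phi (j, b)) (inball (S m.+1 (word m.+1 (j, b)))).
    by apply: open_nbhs_nbhs; split; [exact: open_metric_ball|exact: phiP].
  apply: filterS => y yb b' phib.
  suff /(congr1 snd)/mkseq_agree bb : word m.+1 (j, b) = word m.+1 (j, b').
    by move=> i ni; apply: bb; rewrite (leq_trans ni)// leqW.
  apply/eqP; apply: contrapT => /negP ww; apply: Fn1.
  have [_ _ _ SF] := Sstep m.
  have [|||_ /(_ ww)] := SF (word m.+1 (j, b)) (word m.+1 (j, b')) y y _ _ yb.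
  - exact: word_active.
  - exact: word_active.
  - by rewrite -phib; exact: phiP.
  - by rewrite mulVg; exact: Fmono.
- move=> _ [b _ <-]; split; first exact: (BP j).2 (phiP (j, b) 0%N).
  move=> n _; apply: (@Fmono (maxn n j)); first exact: leq_maxl.
  by have [] := phiF (maxn n j) (j, b) (j, b) (leq_maxr _ _) (leq_maxr _ _).
- move=> _ _ [j _ [b _ <-]] [j' _ [b' _ <-]] ne n _.
  have [k kP] : exists k, forall m, (k <= m)%N -> word m (j, b) != word m (j', b').
    have [jj|jj] := eqVneq j j'; last first.
      by exists 0%N => m _; apply/eqP => -[/eqP]; rewrite (negbTE jj).
    have [k bk] : exists k, b k <> b' k.
      apply: contrapT => h; apply: ne; rewrite jj; congr (phi (_, _)).
      by apply/funext => k; apply: contrapT => bk; apply: h; exists k.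
    exists k.+1 => m km; apply/eqP => -[_ /mkseq_agree bb].
    exact/bk/bb.
  pose m := maxn n (maxn k (maxn j j')).
  have [nm km jm j'm] : [/\ (n <= m)%N, (k <= m)%N, (j <= m)%N & (j' <= m)%N].
    by split; rewrite !leq_max leqnn ?orbT.
  apply: (Fmono m) => //.
  by have [//|//|_] := phiF m (j, b) (j', b'); apply; apply: kP; exact: leqW.
Qed.

End mycielski.

(** * Orbits measured from the identity *)

Section dynamics.
Context (R : realType) (G : topologicalGroupType) (d : G -> G -> R).
Hypothesis dC : compatible_metric d.
Hypothesis d_inv : left_invariant d.
Variable T : {multiplicative G -> G}.
Hypothesis T_cont : continuous T.

Definition orbit_norm (n : nat) (x : G) : R := d (iter n T x) 1%g.

Lemma iter_mul n x y : iter n T (x * y)%g = (iter n T x * iter n T y)%g.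
Proof. by elim: n => //= n ->; rewrite gmulfM. Qed.

Lemma iter_id n : iter n T 1%g = 1%g.
Proof. by apply: (@mulgI _ (iter n T 1%g)); rewrite -iter_mul !mulg1. Qed.

Lemma iter_inv n x : iter n T x^-1%g = (iter n T x)^-1%g.
Proof.
by apply: (@mulgI _ (iter n T x)); rewrite -iter_mul !mulgV iter_id.
Qed.

(** Left invariance together with multiplicativity of the iterates: the
    reduction of pairs to points. *)
Lemma orbit_distE n x y :
  d (iter n T x) (iter n T y) = orbit_norm n (x^-1 * y)%g.
Proof.
have [[_ _ sym _] _] := dC.
rewrite /orbit_norm iter_mul iter_inv sym.
by rewrite -(d_inv _ _ (iter n T x)^-1%g) mulVg.
Qed.

Lemma orbit_norm_id n : orbit_norm n 1%g = 0.
Proof. by have [[xx _ _ _] _] := dC; rewrite /orbit_norm iter_id xx. Qed.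

Lemma orbit_normV n x : orbit_norm n x^-1%g = orbit_norm n x.
Proof.
have [[_ _ sym _] _] := dC.
by rewrite -[in LHS](mulg1 x^-1%g) -orbit_distE iter_id.
Qed.

Lemma orbit_normM n x y :
  orbit_norm n (x * y)%g <= orbit_norm n x + orbit_norm n y.
Proof.
have [[_ _ sym tri] _] := dC.
rewrite -(orbit_normV n x) -{1}(invgK x) -orbit_distE.
have := tri 1%g (iter n T x^-1%g) (iter n T y).
by rewrite (sym 1%g).
Qed.

Lemma orbit_norm_iter n m x :
  orbit_norm n (iter m T x) = orbit_norm (n + m) x.
Proof. by rewrite /orbit_norm iterD. Qed.

Lemma orbit_norm_continuous n : continuous (orbit_norm n).
Proof.
move=> x; apply: (@continuous_comp _ _ _ (iter n T) (fun y => d y 1%g)).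
  elim: n x => [x|n IH x]; first exact: cvg_id.
  by apply: (@continuous_comp _ _ _ (iter n T) T); [exact: IH|exact: T_cont].
exact: continuous_metric_to.
Qed.

Lemma open_orbit_norm_lt n e : open [set x | orbit_norm n x < e].
Proof.
have := @open_comp _ _ (orbit_norm n) [set t | t < e].
by apply => [x _|]; [exact: orbit_norm_continuous|exact: open_lt].
Qed.

Lemma open_orbit_norm_gt n e : open [set x | e < orbit_norm n x].
Proof.
have := @open_comp _ _ (orbit_norm n) [set t | e < t].
by apply => [x _|]; [exact: orbit_norm_continuous|exact: open_gt].
Qed.

Definition proximal_to_id (x : G) : Prop :=
  forall e, 0 < e -> density_ge (1 : R) [set n | orbit_norm n x < e].

Definition distant (c : R) (x : G) : Prop :=
  density_ge c [set n | c < orbit_norm n x].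

Lemma dist_proximalE x y :
  dist_proximal d T x y <-> proximal_to_id (x^-1 * y)%g.
Proof.
split=> xy e /xy; rewrite upper_density1P.
  by apply: density_ge_sub => n /=; rewrite orbit_distE.
by apply: density_ge_sub => n /=; rewrite orbit_distE.
Qed.

Lemma dist_proximal_id y : dist_proximal d T 1%g y <-> proximal_to_id y.
Proof. by rewrite dist_proximalE invg1 mul1g. Qed.

Lemma dist_chaotic_pair2E c x y : dist_chaotic_pair2 d T c x y <->
  proximal_to_id (x^-1 * y)%g /\ distant c (x^-1 * y)%g.
Proof.
rewrite /dist_chaotic_pair2 dist_proximalE ge_upper_density.
by split=> -[? xy]; split=> //; apply: density_ge_sub xy => n /=;
  rewrite orbit_distE.
Qed.

Lemma distant_sub (c c' : R) (A : set nat) x : c' <= c -> density_ge c A ->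
  (forall n, A n -> c' < orbit_norm n x) -> distant c' x.
Proof. by move=> cc cA An; apply: density_ge_le cc _; exact: density_ge_sub cA. Qed.

Lemma distant_mul c x y : distant c (x * y)%g ->
  distant (c / 2) x \/ distant (c / 2) y.
Proof.
move=> xy; apply: density_geU; apply: density_ge_sub xy => n /= cxy.
have := orbit_normM n x y.
by have [xc|cx] := ltP (c / 2) (orbit_norm n x); [left|right=> /=; lra].
Qed.

Lemma distant_id c : 0 < c -> ~ distant c 1%g.
Proof.
move=> c0 /(density_ge_unbounded 0 c0)[n _ /=].
by rewrite orbit_norm_id ltNge (ltW c0).
Qed.

(** The two bounds of positivity, of the density of B and of the liminf along
    B, are merged into one constant c by taking their minimum. *)
Lemma dist_semi_irregular2P x : dist_semi_irregular2 d T x <->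
  proximal_to_id x /\ exists2 c, 0 < c & distant c x.
Proof.
split=> [[[A /upper_density1P A1 Ax] [B /upper_density_gt0P[b b0 bB]]]|
    [/density1_diagonal[A A1 Ax] [c c0 cx]]].
- move=> /limf_einf_gt0P[c c0 [N _ NB]]; split=> [e e0|].
    have : nbhs (1%g : G) [set y | d y 1%g < e].
      apply/(nbhs_metricP dC); exists e => // z.
      by have [[_ _ -> _] _] := dC.
    move=> /Ax [M _ MA].
    by apply: (@density_ge_eventually _ _ _ _ M) A1 => i; exact: MA.
  exists (Num.min b c); first by rewrite lt_min b0.
  apply: (@density_ge_le _ b); first by rewrite ge_min lexx.
  apply: (@density_ge_eventually _ _ _ _ N) bB => i Ni Bi /=.
  by rewrite gt_min (NB _ Ni Bi) orbT.
- split.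
    exists A; first exact/upper_density1P.
    move=> W /(nbhs_metricP dC)[e e0 eW].
    have [N NA] := Ax e e0; exists N => // n /= Nn An; apply: eW.
    by have [[_ _ -> _] _] := dC; exact: NA.
  exists [set n | c < orbit_norm n x]; first by apply/upper_density_gt0P; exists c.
  by apply/limf_einf_gt0P; exists c => //; exists 0%N.
Qed.

(** Choose y proximal to e with z = x^-1 y in W, and write x = y z^-1: one of y
    and z is distant. If z is not, then y is, and some iterate of y lies in W
    since y is proximal to e; iterating only shifts the set of times. *)
Lemma distant_near_id c x : dense proximal_to_id -> distant c x ->
  forall W, nbhs 1%g W -> exists2 z, W z & distant (c / 2) z.
Proof.
move=> prox_dense cx W W1.
have [||y [/= Wy yP]] := prox_dense [set z | (W^° (x^-1 * z))%g].
- exists x; rewrite /= mulVg; apply: nbhs_singleton; exact: nbhs_interior.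
- exact/open_translate/open_interior.
have : distant c (y * (x^-1 * y)^-1)%g by rewrite invgM invgK mulVKg.
move=> /distant_mul[cy|cz]; last first.
  exists (x^-1 * y)%g; first exact: interior_subset.
  by apply: density_ge_sub cz => n /=; rewrite orbit_normV.
have /(nbhs_metricP dC)[e e0 eW] := W1.
have [m _ /= ym] := density_ge_unbounded 0 ltr01 (yP e e0).
exists (iter m T y).
  by apply: eW; have [[_ _ -> _] _] := dC.
apply: density_ge_sub (density_ge_shift m cy) => n /=.
by rewrite orbit_norm_iter.
Qed.

(** If z is distant, then for every y one of y and y z is distant; take z so
    close to e that y z stays in the given open set. *)
Lemma distant_dense c x : dense proximal_to_id -> distant c x ->
  dense (distant (c / 2 / 2)).
Proof.
move=> prox_dense cx O [y Oy] Oo.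
have [|z Oz] := @distant_near_id c x prox_dense cx [set z | O (y * z)%g].
  apply: open_nbhs_nbhs; split; last by rewrite /= mulg1.
  by have := @open_translate _ y^-1%g _ Oo; rewrite invgK.
rewrite -{1}(mulKg y z) => /distant_mul[yc|yzc]; last by exists (y * z)%g.
exists y; split=> //.
by apply: density_ge_sub yc => n /=; rewrite orbit_normV.
Qed.

(** Membership only involves finitely many of the open conditions u_i, and
    the count can only grow when more of them hold. *)
Lemma open_card_upto (u : nat -> set G) (q : R) k :
    (forall i, open (u i)) ->
  open [set x | exists2 n, (k <= n)%N &
    q * n%:R < (card_upto [set i | u i x] n)%:R].
Proof.
move=> uo; rewrite openE => x /= [n kn qn].
have : \forall y \near x, forall i, (i <= n)%N -> u i x -> u i y.
  elim: n {kn qn} => [|n IH].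
    have [ux|nux] := pselect (u 0 x).
      have : nbhs x (u 0) by apply: open_nbhs_nbhs.
      by apply: filterS => y uy i; rewrite leqn0 => /eqP ->.
    by apply: nearW => y i; rewrite leqn0 => /eqP ->.
  have [ux|nux] := pselect (u n.+1 x).
    have : nbhs x (u n.+1) by apply: open_nbhs_nbhs.
    apply: filterS2 IH => y IH uy i.
    by rewrite leq_eqVlt => /predU1P[->//|]; exact: IH.
  apply: filterS IH => y IH i.
  by rewrite leq_eqVlt => /predU1P[->//|]; exact: IH.
apply: filterS => y xy; exists n => //; apply: lt_le_trans qn _.
rewrite ler_nat -[leqRHS]addn0; apply: card_upto_window => i /andP[_ ni].
exact: xy.
Qed.

(** The stages exhibit the points proximal to e and the distant points as
    countable intersections of open sets: a single index k serves as the time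
    threshold and as both tolerances, which also makes the stages decreasing. *)
Definition proximal_stage (k : nat) : set G :=
  [set x | exists2 n, (k <= n)%N & (1 - k.+1%:R^-1) * n%:R <
     (card_upto [set i | orbit_norm i x < k.+1%:R^-1] n)%:R :> R].

Definition distant_stage (c : R) (k : nat) : set G :=
  [set x | exists2 n, (k <= n)%N & (c - k.+1%:R^-1) * n%:R <
     (card_upto [set i | c < orbit_norm i x] n)%:R].

Definition chaotic_stage (c : R) (k : nat) : set G :=
  proximal_stage k `&` distant_stage c k.

Lemma open_proximal_stage k : open (proximal_stage k).
Proof.
apply: (@open_card_upto (fun i => [set x | orbit_norm i x < k.+1%:R^-1])) => i.
exact: open_orbit_norm_lt.
Qed.

Lemma open_distant_stage c k : open (distant_stage c k).
Proof.
apply: (@open_card_upto (fun i => [set x | c < orbit_norm i x])) => i.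
exact: open_orbit_norm_gt.
Qed.

Lemma open_chaotic_stage c k : open (chaotic_stage c k).
Proof. exact: openI (open_proximal_stage k) (open_distant_stage c k). Qed.

Lemma chaotic_stageV c k x : chaotic_stage c k x -> chaotic_stage c k x^-1%g.
Proof.
move=> [[n kn nP] [m km mP]]; split; [exists n|exists m] => //.
  apply: lt_le_trans nP _; rewrite ler_nat -[leqRHS]addn0.
  by apply: card_upto_window => i _; rewrite /= orbit_normV.
apply: lt_le_trans mP _; rewrite ler_nat -[leqRHS]addn0.
by apply: card_upto_window => i _; rewrite /= orbit_normV.
Qed.

Lemma chaotic_stage_decr c k : chaotic_stage c k.+1 `<=` chaotic_stage c k.
Proof.
have kk : k.+2%:R^-1 <= k.+1%:R^-1 :> R by rewrite lef_pV2 ?posrE// ler_nat.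
have kn (a : R) (n : nat) : (a - k.+1%:R^-1) * n%:R <= (a - k.+2%:R^-1) * n%:R.
  by rewrite ler_wpM2r// lerB.
move=> x [[n kn1 n1] [m km m1]]; split.
  exists n; first exact: ltnW.
  apply: le_lt_trans (kn _ _) (lt_le_trans n1 _).
  rewrite ler_nat -[leqRHS]addn0; apply: card_upto_window => i _ /= xi.
  exact: lt_le_trans kk.
by exists m; [exact: ltnW|exact: le_lt_trans (kn _ _) m1].
Qed.

Lemma bigcap_chaotic_stage c :
  \bigcap_k chaotic_stage c k = proximal_to_id `&` distant c.
Proof.
have small (e : R) N : 0 < e -> exists2 k, (N <= k)%N & k.+1%:R^-1 <= e.
  move=> e0; exists (maxn N (Num.truncn e^-1)); first exact: leq_maxl.
  rewrite -[leRHS]invrK lef_pV2 ?posrE ?invr_gt0// ltW//.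
  by apply: lt_le_trans (truncnS_gt _) _; rewrite ler_nat ltnS leq_maxr.
apply/seteqP; split=> x xP.
  split=> [e e0 e' e'0 N|e e0 N].
    have ee'0 : 0 < Num.min e e' by rewrite lt_min e0.
    have [k Nk] := small _ N ee'0; rewrite le_min => /andP[ke ke'].
    have [[n kn nP] _] := xP k I; exists n; first exact: leq_trans kn.
    apply: (@le_lt_trans _ _ ((1 - k.+1%:R^-1) * n%:R)).
      by rewrite ler_wpM2r// lerB.
    apply: lt_le_trans nP _.
    rewrite ler_nat -[leqRHS]addn0; apply: card_upto_window => i _ /= xi.
    exact: lt_le_trans ke.
  have [k Nk ke] := small e N e0.
  have [_ [n kn nP]] := xP k I; exists n; first exact: leq_trans kn.
  by apply: le_lt_trans nP; rewrite ler_wpM2r// lerB.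
move=> k _; have k0 : 0 < k.+1%:R^-1 :> R by rewrite invr_gt0.
by have [xp xd] := xP; split; [exact: xp|exact: xd].
Qed.

Lemma dense_chaotic_stage c k :
  dense proximal_to_id -> dense (distant c) -> dense (chaotic_stage c k).
Proof.
move=> prox_dense dist_dense O On Oo.
have k0 : 0 < k.+1%:R^-1 :> R by rewrite invr_gt0.
have [x [Ox xp]] := prox_dense O On Oo.
have [||y [[Oy yp] yd]] := dist_dense (O `&` proximal_stage k).
- by exists x; split=> //; exact: xp.
- exact: openI (open_proximal_stage k).
by exists y; split=> //; split=> //; exact: yd.
Qed.

End dynamics.

(** * The equivalences *)

Lemma cantor_set_two_points (R : realType) (X : topologicalType) (K : set X) :
  cantor_set R K -> exists x y, [/\ K x, K y & x <> y].
Proof.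
move=> [f [g [_ _ fK _ [fgK _]]]].
pose t b : R := ternary R (fun=> b).
have tC b : cantor_ternary (t b) by apply/cantor_ternaryP; exists (fun=> b).
exists (f (t true)), (f (t false)); split; [exact: fK|exact: fK|].
move=> /(congr1 g); rewrite !fgK ?inE// => tt.
suff : true = false by [].
apply: (@agree_ternary R (fun=> true) (fun=> false) 1 _ 0%N) => //.
by rewrite -[X in X - _]/(t true) tt subrr normr0 expr1 invr_gt0.
Qed.

Theorem theorem5p17 (R : realType) (G : topologicalGroupType)
  (G_cm : completely_metrizable R G)
  (d : G -> G -> R) (d_compat : compatible_metric d)
  (d_inv : left_invariant d)
  (T : {multiplicative G -> G}) (T_cont : continuous T) :
  [<-> dense [set x | dist_semi_irregular2 d T x];
       residual [set x | dist_semi_irregular2 d T x];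
       exists2 delta : R, 0 < delta &
         forall O : nat -> set G, (forall j, open (O j) /\ O j !=set0) ->
           exists2 K : nat -> set G,
             (forall j, cantor_set R (K j) /\ K j `<=` O j) &
             dist_scrambled2 d T delta (\bigcup_j K j);
       dense (dist_proximal_relation d T) /\ mean_L_unstable d T;
       dense (dist_proximal_cell d T 1%g) /\
         exists (x : G) (delta : R), 0 < delta /\
           (0 < upper_density R [set n | (delta < d (iter n T x) 1%g)%R])%E].
Proof.
have dense_sub (X : topologicalType) (A B : set X) : A `<=` B -> dense A -> dense B.
  by move=> AB Ad O On Oo; have [x [Ox Ax]] := Ad O On Oo; exists x; split=> //; exact: AB.
have semiP := dist_semi_irregular2P d_compat T.
have irregular_prox : dense [set x | dist_semi_irregular2 d T x] ->
    dense (proximal_to_id d T) /\ exists2 c, 0 < c & exists x, distant d T c x.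
  move=> semi_dense; split; first by apply: dense_sub semi_dense => x /semiP[].
  have [|x [_ /semiP[_ [c c0 cx]]]] := semi_dense setT _ openT; first by exists 1%g.
  by exists c => //; exists x.
(* The weak form of the assertions yields Cantor sets made of irregular points
   whose quotients are irregular too, with one constant for all families O. *)
have core : dense (proximal_to_id d T) /\ (exists2 c, 0 < c & exists x, distant d T c x) ->
    exists2 c, 0 < c & forall O : nat -> set G,
      (forall j, open (O j) /\ O j !=set0) ->
    exists K : nat -> set G,
      (forall j, cantor_set R (K j) /\
        K j `<=` O j `&` \bigcap_n chaotic_stage d T c n) /\
      forall x y, (\bigcup_j K j) x -> (\bigcup_j K j) y -> x <> y ->
        (\bigcap_n chaotic_stage d T c n) (x^-1 * y)%g.
  move=> [prox_dense [c c0 [x cx]]]; exists (c / 2 / 2); first by rewrite !divr_gt0.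
  have dist_dense := distant_dense d_compat d_inv prox_dense cx.
  have [rho rhoC rho_complete] := G_cm.
  move=> O OP; apply: (mycielski rhoC) => //.
  - by move=> n; exact: open_chaotic_stage.
  - by move=> n; exact: dense_chaotic_stage.
  - by move=> n y; exact: chaotic_stageV.
  - by move=> n; exact: chaotic_stage_decr.
  - rewrite bigcap_chaotic_stage => -[_]; apply: distant_id => //.
    by rewrite !divr_gt0.
tfae.
- move=> /irregular_prox/core[c c0 cP].
  exists (\bigcap_n chaotic_stage d T c n).
    split.
      by exists (chaotic_stage d T c) => // n; exact: open_chaotic_stage.
    move=> O On Oo; have [//|K [KP _]] := cP (fun=> O).
    have [/cantor_set_two_points[x [_ [Kx _ _]]] KO] := KP 0%N.
    by exists x; exact: KO.
  rewrite bigcap_chaotic_stage => x [xp xd]; apply/semiP; split=> //.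
  by exists c.
- move=> [D [_ D_dense] Dsub].
  have /irregular_prox/core[c c0 cP] := dense_sub _ _ _ Dsub D_dense.
  exists c => // O /cP[K [KP KD]]; exists K.
    by move=> j; have [Kc KO] := KP j; split=> // x /KO[].
  move=> x y Kx Ky xy; apply/(dist_chaotic_pair2E d_compat d_inv).
  by have := KD x y Kx Ky xy; rewrite bigcap_chaotic_stage.
- move=> [c c0 cP]; split.
    move=> O [[a b] Oab] Oo.
    have : nbhs (a, b) O by exact: open_nbhs_nbhs.
    move=> [[/= A B] [/= Aa Bb] AB].
    have [|K KP KD] := cP (fun j => if j is 0%N then A^° else B^°).
      by case=> [|j]; split; do ?exact: open_interior; [exists a|exists b].
    have [/cantor_set_two_points[x [_ [Kx _ _]]] KA] := KP 0%N.
    have [/cantor_set_two_points[y [z [Ky Kz yz]]] KB] := KP 1%N.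
    have [t [Kt xt]] : exists t, K 1%N t /\ x <> t.
      by have [xy|xy] := pselect (x = y); [exists z; rewrite xy|exists y].
    exists (x, t); split.
      by apply: AB; split; apply: interior_subset; [exact: KA|exact: KB].
    by have [] := KD x t _ _ xt; [exists 0%N|exists 1%N|].
  (* Two scrambled points of the ball around x are often more than c apart, hence
     one of them is often more than c / 2 away from the orbit of x. *)
  exists (c / 2); first by rewrite divr_gt0.
  move=> x e e0.
  have [|K KP KD] := cP (fun=> [set y | d x y < e]).
    move=> _; split; first exact: open_metric_ball.
    by exists x => /=; have [[-> _ _ _] _] := d_compat.
  have [/cantor_set_two_points[y [z [Ky Kz yz]]] KO] := KP 0%N.
  have [||_] := KD y z _ _ yz; [by exists 0%N|by exists 0%N|].
  move=> /ge_upper_density yzc.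
  have [[_ _ sym tri] _] := d_compat.
  have : density_ge c ([set n | c / 2 < d (iter n T x) (iter n T y)] `|`
                       [set n | c / 2 < d (iter n T x) (iter n T z)]).
    apply: density_ge_sub yzc => n /= cn.
    have := tri (iter n T x) (iter n T y) (iter n T z).
    rewrite (sym _ (iter n T x)).
    by have [?|?] := ltP (c / 2) (d (iter n T x) (iter n T y)); [left|right => /=; lra].
  move=> /density_geU[?|?]; [exists y|exists z]; do ?exact: KO; exact/ge_upper_density.
- move=> [rel_dense [c c0 cP]]; split.
    move=> O [y Oy] Oo.
    (* Quotients of proximal pairs are proximal to e, and they are dense since the
       pairs with quotient in O form a nonempty open set. *)
    have [||[a b] [/= Oab ab]] := rel_dense [set p | O (p.1^-1 * p.2)%g].
    + by exists (1%g, y) => /=; rewrite invg1 mul1g.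
    + by apply: open_comp Oo => p _; exact: continuous_ldivg.
    exists (a^-1 * b)%g; split=> //; apply/(dist_proximal_id d_compat d_inv).
    exact/(dist_proximalE d_compat d_inv).
  have [y _ cy] := cP 1%g 1 ltr01.
  exists y, c; split=> //; apply: lt_le_trans (_ : (c%:E <= _)%E); first by rewrite lte_fin.
  apply/ge_upper_density; move/ge_upper_density: cy.
  apply: density_ge_sub => n /=.
  by rewrite (iter_id T); have [[_ _ -> _] _] := d_compat.
- move=> [cell_dense [x [c [c0 /upper_density_gt0P[a a0 ax]]]]].
  have /core[b b0 bP] : dense (proximal_to_id d T) /\
      exists2 c, 0 < c & exists x, distant d T c x.
    split; first by apply: dense_sub cell_dense => y /(dist_proximal_id d_compat d_inv).
    exists (Num.min a c); first by rewrite lt_min a0.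
    exists x; apply: (@distant_sub _ _ _ _ a _ [set n | c < d (iter n T x) 1%g]) => //.
      by rewrite ge_min lexx.
    by move=> n cn; rewrite gt_min cn orbT.
  move=> O On Oo; have [//|K [KP _]] := bP (fun=> O).
  have [/cantor_set_two_points[y [_ [Ky _ _]]] KO] := KP 0%N.
  have [Oy] := KO _ Ky; rewrite bigcap_chaotic_stage => -[yp yd].
  by exists y; split=> //; apply/semiP; split=> //; exists b.
Qed.
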